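(* Let $\mathcal H$ be a Hilbert space and let $A,B$ be bounded linear operators on $\mathcal H$ such that $0<m\le A,B\le M$ for scalars $m,M$. Let $0\le t\le 1$. Then for any unit vector $x\in\mathcal H$, \[\left\langle Ax,x\right\rangle^{1-t}\left\langle Bx,x\right\rangle^{t}\le \frac{1}{K^2\left(\sqrt{\frac{m}{M}},\sqrt{\frac{M}{m}},t\right)}\,\frac{(M+m)^2}{4Mm}\left\langle (A\natural_t B)x,x\right\rangle.\]
   Context: For real scalars, $m\le A\le M$ means $mI\le A\le MI$ in the usual order on self-adjoint operators ($A\ge B$ iff $A-B$ is positive semi-definite); ''$m\le A,B\le M$'' means this holds for both $A$ and $B$. For positive definite $A,B$, $A\sharp B=A^{1/2}(A^{-1/2}BA^{-1/2})^{1/2}A^{1/2}$, and for $0\le t\le1$ the weighted spectral geometric mean is $A\natural_t B=(A^{-1}\sharp B)^{t}A(A^{-1}\sharp B)^{t}$. The generalized Kantorovich constant is, for $0<a<b$ and $t\in\mathbb R$, \[K(a,b,t)=\frac{ab^t-ba^t}{(t-1)(b-a)}\left(\frac{t-1}{t}\,\frac{b^t-a^t}{ab^t-ba^t}\right)^t,\] with the value $1$ (the limiting value) when $t\in\{0,1\}$ or $a=b$. $K^2(\cdot)$ denotes the square of $K(\cdot)$. *)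

(* Defs.v *)
From mathcomp Require Export all_boot all_order all_algebra.
From mathcomp Require Export sesquilinear complex.
From mathcomp Require Export all_classical all_reals all_analysis.

Set Implicit Arguments.
Unset Strict Implicit.
Unset Printing Implicit Defensive.

Import Order.TTheory GRing.Theory Num.Theory.
Import numFieldNormedType.Exports.

Local Open Scope classical_set_scope.
Local Open Scope ring_scope.
Local Open Scope complex_scope.

(* A complex Hilbert space is a complete normed space H over R[i] whose norm
   comes from an inner product dot, linear in its first argument.  Operators
   are bare functions H -> H. *)
Definition is_inner_product (R : realType) (H : completeNormedModType R[i])
    (dot : {dot H for Num.conj}) : Prop :=
  forall x : H, `|x| ^+ 2 = dot x x.

Section Operators.
Variables (R : realType) (H : completeNormedModType R[i]).
Implicit Types (A B T S : H -> H) (f : R -> R).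

Definition bounded_op T : Prop :=
  linear T /\ exists c : R, forall x, `|T x| <= c%:C * `|x|.

Definition is_inverse T S : Prop :=
  [/\ bounded_op S, cancel S T & cancel T S].

Definition inv_op T : H -> H := get (is_inverse T).

Definition spectrum T : set R[i] :=
  [set l | ~ exists S, is_inverse (fun x => T x - l *: x) S].

Definition poly_op (p : {poly R}) T : H -> H :=
  fun x => \sum_(i < size p) (p`_i)%:C *: iter i T x.

(* Continuous functional calculus: S = f(T) when S is the limit in operator
   norm of polynomials in T that converge to f uniformly on the spectrum of T.
   For T self-adjoint the spectrum is real and ||p(T)|| is the supremum of |p|
   on it, so there is exactly one such S if f is continuous on the spectrum. *)
Definition is_fcalc f T S : Prop :=
  bounded_op S /\
  forall e : R, 0 < e -> exists p : {poly R},
    (forall l : R, spectrum T l%:C -> `|p.[l] - f l| <= e) /\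
    (forall x, `|poly_op p T x - S x| <= e%:C * `|x|).

Definition fcalc f T : H -> H := get (is_fcalc f T).

(* Used for positive invertible T, whose spectrum lies in ]0, +oo[. *)
Definition pow_op T (s : R) : H -> H := fcalc (fun l => l `^ s) T.

Definition geo_mean A B : H -> H :=
  pow_op A 2^-1
    \o pow_op (pow_op A (- 2^-1) \o B \o pow_op A (- 2^-1)) 2^-1
    \o pow_op A 2^-1.

Definition spectral_geo_mean (t : R) A B : H -> H :=
  let G := geo_mean (inv_op A) B in pow_op G t \o A \o pow_op G t.

Variable dot : {dot H for Num.conj}.

Definition self_adjoint T : Prop := forall x y, dot (T x) y = dot x (T y).

(* In R[i], 0 <= z means that z is real and nonnegative. *)
Definition psd_op T : Prop := self_adjoint T /\ forall x, 0 <= dot (T x) x.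

Definition le_op A B : Prop :=
  [/\ self_adjoint A, self_adjoint B & psd_op (fun x => B x - A x)].

Definition scalar_op (a : R) : H -> H := fun x => a%:C *: x.

(* <T x, x>, which is real for T self-adjoint. *)
Definition quad T (x : H) : R := complex.Re (dot (T x) x).

End Operators.

(* For 0 < a < b every base of `^ is positive, including the last one: for t
   in ]0, 1[ both (t - 1) / t and a * b `^ t - b * a `^ t are negative. *)
Definition kantorovich (R : realType) (a b t : R) : R :=
  if [|| t == 0, t == 1 | a == b] then 1 else
  (a * b `^ t - b * a `^ t) / ((t - 1) * (b - a)) *
  ((t - 1) / t * ((b `^ t - a `^ t) / (a * b `^ t - b * a `^ t))) `^ t.

(* Main.v *)
(* Put G = A^-1 # B, so that G A G = B and A natural_t B = G^t A G^t.  From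
   m G^2 <= G A G <= M and m <= G A G <= M G^2 the spectrum of G lies in
   [sqrt (m/M), sqrt (M/m)].  For the unit vector x:
   - Cauchy-Schwarz for the form <A ., .> gives
     <G^t x, x>^2 <= <A G^t x, G^t x> <A^-1 x, x>;
   - l^t lies above its chord, hence <G^t x, x> >= K <G x, x>^t;
   - Kantorovich: <A x, x> <A^-1 x, x> <= k with k = (M+m)^2 / (4Mm), and
     <B x, x> <A^-1 x, x> <= k <G x, x>^2, since with P = A^(-1/2) one has
     G = P D P, where D = (P^-1 B P^-1)^(1/2) satisfies (D - m)(M - D) >= 0.
   The weighted geometric mean of the last two inequalities concludes.

   The calculus f(T) rests on one fact: for T self-adjoint and p real, p >= c on
   the real spectrum implies p(T) >= c.  Indeed the infimum d of the numerical
   range of p(T) is an approximate eigenvalue; factoring p - d over the complex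
   numbers, some T - r with p(r) = d is not bounded below, and r must be real. *)

Require Import Defs.
From mathcomp Require Import ring lra.

Import Order.TTheory GRing.Theory Num.Theory.
Import numFieldNormedType.Exports.

Set Implicit Arguments.
Unset Strict Implicit.
Unset Printing Implicit Defensive.

Local Open Scope ring_scope.
Local Open Scope complex_scope.

(** * Uniform approximation of powers and the Kantorovich constant *)

Section Bernstein.
Variable R : realFieldType.
Implicit Types (u : {poly R}) (phi psi : nat -> R) (x y c : R).

(* de Casteljau recursion for \sum_k phi k 'C(n, k) u^k (1 - u)^(n - k). *)
Fixpoint bernstein u (n : nat) phi : {poly R} :=
  if n is n'.+1 then
    (1 - u) * bernstein u n' phi + u * bernstein u n' (fun k => phi k.+1)
  else (phi 0%N)%:P.

Lemma le_bernstein u n phi psi x : 0 <= u.[x] <= 1 ->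
  (forall k, (k <= n)%N -> phi k <= psi k) ->
  (bernstein u n phi).[x] <= (bernstein u n psi).[x].
Proof.
move=> /andP[u0 u1]; elim: n phi psi => [|n IHn] phi psi h /=.
  by rewrite !hornerC h.
rewrite !hornerE lerD// ler_wpM2l ?subr_ge0// IHn// => k kn; apply: h => //.
exact: leqW.
Qed.

Lemma bernstein_linear u n a c phi psi x :
  (bernstein u n (fun k => a * phi k + c * psi k)).[x] =
  a * (bernstein u n phi).[x] + c * (bernstein u n psi).[x].
Proof.
elim: n phi psi => [|n IHn] phi psi /=; first by rewrite !hornerC.
by rewrite !hornerE !IHn; ring.
Qed.

Lemma bernstein_cst u n c x : (bernstein u n (fun=> c)).[x] = c.
Proof. by elim: n => [|n IHn] /=; rewrite ?hornerC// !hornerE IHn; ring. Qed.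

(** Squared bias plus variance of a binomial variable with n trials. In the induction a success
    shifts the centre from c to c - 1. *)
Lemma bernstein_sqr u n c x : (bernstein u n (fun k => (k%:R - c) ^+ 2)).[x] =
  (n%:R * u.[x] - c) ^+ 2 + n%:R * u.[x] * (1 - u.[x]).
Proof.
elim: n c => [|n IHn] c /=; first by rewrite hornerC; ring.
rewrite !hornerE IHn.
have -> : (fun k : nat => (k.+1%:R - c) ^+ 2) = (fun k => (k%:R - (c - 1)) ^+ 2).
  by apply/funext => k; rewrite -natr1; congr (_ ^+ 2); ring.
by rewrite IHn -natr1; ring.
Qed.

End Bernstein.

Section UniformApproximation.
Variable R : realType.
Implicit Types (f : R -> R) (a b L e : R).

Definition lipschitz_on f a b L :=
  forall x y, a <= x <= b -> a <= y <= b -> `|f x - f y| <= L * `|x - y|.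

(** Bernstein's argument: for y the node of index k, |f y - f x| <= L |y - x| <= L (d + (y - x)^2 /
    d), and the Bernstein average of the right side is known exactly from the variance. The choices
    of d and n make each of its two terms at most e / 2. *)
Lemma lipschitz_poly_approx f a b L e : a < b -> 0 <= L ->
  lipschitz_on f a b L -> 0 < e ->
  exists p : {poly R}, forall x, a <= x <= b -> `|p.[x] - f x| <= e.
Proof.
move=> ab L0 fL e0.
(* This gives L * d <= e / 2, and [L + 1] keeps the divisor positive when L = 0. *)
pose d := e / (2 * (L + 1)).
have L1 : 0 < L + 1 by lra.
have d0 : 0 < d by rewrite divr_gt0// mulr_gt0.
pose c := (L / d) * (b - a) ^+ 2.
have c0 : 0 <= c by rewrite mulr_ge0 ?sqr_ge0// divr_ge0// ltW.
have [n [n0 hn]] : exists n : nat, (0 < n)%N /\ c * 2 <= e * n%:R.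
  exists (Num.truncn (c * 2 / e)).+1; split => //.
  rewrite [leRHS]mulrC -ler_pdivrMr//; apply/ltW.
  exact: truncnS_gt.
pose u : {poly R} := (b - a)^-1 *: ('X - a%:P).
pose phi (k : nat) := f (a + (b - a) * (k%:R / n%:R)).
have nR : 0 < n%:R :> R by rewrite ltr0n.
have ba : 0 < b - a by lra.
exists (bernstein u n phi) => x xab.
have ux : u.[x] = (x - a) / (b - a) by rewrite /u !hornerE mulrC.
have u01 : 0 <= u.[x] <= 1.
  by rewrite ux divr_ge0 ?ler_pdivrMr//=; lra.
have uxE : (b - a) * u.[x] = x - a by rewrite ux mulrC divfK// gt_eqF.
pose psi (k : nat) : R := L * d * 1 + (L / d * ((b - a) / n%:R) ^+ 2) * (k%:R - n%:R * u.[x]) ^+ 2.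
have psiE : (bernstein u n psi).[x] <= e.
  rewrite /psi (bernstein_linear u n (L * d) _ (fun=> 1)) bernstein_cst bernstein_sqr.
  rewrite subrr expr0n add0r mulr1.
  have -> : L / d * ((b - a) / n%:R) ^+ 2 * (n%:R * u.[x] * (1 - u.[x])) =
      c / n%:R * (u.[x] * (1 - u.[x])).
    by rewrite /c; field; rewrite !gt_eqF.
  have : L * d <= e / 2.
    rewrite /d; have -> : L * (e / (2 * (L + 1))) = (e / 2) * (L / (L + 1)).
      by field; rewrite gt_eqF.
    by rewrite ler_piMr ?ler_pdivrMr// ?divr_ge0//; lra.
  have : c / n%:R * (u.[x] * (1 - u.[x])) <= e / 2 * 1.
    apply: ler_pM; [by rewrite divr_ge0|nra| |nra].
    by rewrite ler_pdivrMr//; lra.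
  lra.
have key k : (k <= n)%N -> `|phi k - f x| <= psi k.
  move=> kn.
  have kn1 : 0 <= (k%:R / n%:R : R) <= 1.
    by rewrite divr_ge0 ?ler0n//= ler_pdivrMr// mul1r ler_nat.
  set y := a + (b - a) * (k%:R / n%:R).
  have yab : a <= y <= b by rewrite /y; nra.
  apply: (le_trans (fL _ _ yab xab)).
  have h : `|y - x| <= d + (y - x) ^+ 2 / d.
    rewrite -(ler_pM2r d0) mulrDl divfK ?gt_eqF//.
    rewrite -[X in _ <= _ + X]real_normK ?num_real//.
    have := normr_ge0 (y - x); set z := `|y - x|; nra.
  apply: (le_trans (ler_wpM2l L0 h)).
  suff -> : psi k = L * (d + (y - x) ^+ 2 / d) by [].
  have -> : y - x = (b - a) / n%:R * (k%:R - n%:R * u.[x]).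
    rewrite mulrBr [X in _ = _ - X]mulrA divfK ?gt_eqF// uxE /y; field.
    by rewrite gt_eqF.
  by rewrite /psi; field; rewrite !gt_eqF.
have fx1 : (bernstein u n (fun=> f x)).[x] = f x by apply: bernstein_cst.
rewrite ler_norml; apply/andP; split.
  rewrite lerBrDr addrC.
  have -> : f x + - e = 1 * f x + - e by rewrite mul1r.
  apply: (@le_trans _ _ ((bernstein u n (fun k => 1 * f x + (-1) * psi k)).[x])).
    rewrite (bernstein_linear u n 1 (-1) (fun=> f x)) bernstein_cst; lra.
  apply: le_bernstein => // k /key; rewrite ler_norml => /andP[]; lra.
rewrite lerBlDr.
apply: (@le_trans _ _ ((bernstein u n (fun k => 1 * f x + 1 * psi k)).[x])).
  apply: le_bernstein => // k /key; rewrite ler_norml => /andP[]; lra.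
rewrite (bernstein_linear u n 1 1 (fun=> f x)) bernstein_cst; lra.
Qed.

(** The power increases or decreases according to the sign of s; the sum of the two end values
    covers both cases at once. *)
Lemma powR_le_endpoints a b s z : 0 < a -> a <= z <= b ->
  z `^ s <= a `^ s + b `^ s.
Proof.
move=> a0 /andP[az zb]; have z0 : 0 < z by apply: lt_le_trans az.
have b0 : 0 < b by apply: lt_le_trans zb.
have [s0|s0] := leP 0 s.
  by rewrite ler_wpDl ?powR_ge0// ge0_ler_powR// nnegrE ltW.
rewrite ler_wpDr ?powR_ge0// -[s]opprK !(powRN _ (- s)).
rewrite lef_pV2 ?posrE ?powR_gt0// ge0_ler_powR// ?nnegrE ?ltW//; lra.
Qed.

Lemma lipschitz_on_powR a b s : 0 < a ->
  exists2 L, 0 <= L & lipschitz_on (fun l => l `^ s) a b L.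
Proof.
move=> a0; exists (`|s| * (a `^ (s - 1) + b `^ (s - 1))).
  by rewrite mulr_ge0// addr_ge0// powR_ge0.
have main x y : a <= x <= b -> a <= y <= b -> x <= y ->
    `|x `^ s - y `^ s| <= `|s| * (a `^ (s - 1) + b `^ (s - 1)) * `|x - y|.
  move=> /andP[ax xb] /andP[ay yb] xy.
  have := @MVT_segment R (fun z => z `^ s) (fun z => s * z `^ (s - 1)) x y xy.
  case=> [z||z].
  - rewrite in_itv/= => /andP[xz _].
    by apply: is_derive1_powR; apply: lt_trans xz; apply: lt_le_trans ax.
  - apply: continuous_in_subspaceT => z; rewrite inE/= in_itv/= => /andP[xz _].
    apply/differentiable_continuous/derivable1_diffP/derivable_powR.
    by rewrite in_itv/= andbT; apply: lt_le_trans xz; apply: lt_le_trans ax.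
  - rewrite in_itv/= => /andP[xz zy] h.
    rewrite distrC h normrM (distrC x y) ler_wpM2r// normrM ler_wpM2l//.
    rewrite ger0_norm ?powR_ge0// (powR_le_endpoints _ a0)// (le_trans ax xz) (le_trans zy yb)//.
move=> x y xab yab; have [xy|/ltW yx] := leP x y; first exact: main.
by rewrite distrC (distrC x); apply: main.
Qed.

End UniformApproximation.

(** * The Kantorovich constant and the chord of a power function *)

Section Kantorovich.
Variable R : realType.
Implicit Types a b t g : R.

(** Young's inequality for the conjugate exponents 1 / t and 1 / (1 - t), applied to x^t and y^(1 -
    t). *)
Lemma powR_AMGM t x y : 0 < t < 1 -> 0 <= x -> 0 <= y ->
  x `^ t * y `^ (1 - t) <= t * x + (1 - t) * y :> R.
Proof.
move=> /andP[t0 t1] x0 y0; have t10 : 0 < 1 - t by rewrite subr_gt0.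
have tt : t^-1^-1 + (1 - t)^-1^-1 = 1 by rewrite !invrK addrC subrK.
have := conjugate_powR (powR_ge0 x t) (powR_ge0 y (1 - t)) _ _ tt.
rewrite !invr_gt0 t0 t10 !invrK -!powRrM !divff ?gt_eqF// !powRr1//.
by rewrite (mulrC x) (mulrC y); apply.
Qed.

(* Convexity of u^(1/t) between a^t and b^t. *)
Lemma le_powR_chord t a b l : 0 < t < 1 -> 0 < a -> a < b -> a <= l <= b ->
  (b `^ t - a `^ t) / (b - a) * l + (b * a `^ t - a * b `^ t) / (b - a) <=
  l `^ t.
Proof.
move=> /andP[t0 t1] a0 ab /andP[al lb].
have ba : 0 < b - a by rewrite subr_gt0.
have l0 : 0 < l := lt_le_trans a0 al.
have [a0' b0'] : 0 <= a /\ 0 <= b by lra.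
pose s := (l - a) / (b - a).
have s0 : 0 <= s by rewrite divr_ge0 ?subr_ge0// ltW.
have s1 : s <= 1 by rewrite ler_pdivrMr// mul1r; lra.
have -> : (b `^ t - a `^ t) / (b - a) * l + (b * a `^ t - a * b `^ t) / (b - a)
   = s * b `^ t + (1 - s) * a `^ t.
  by rewrite /s; field; rewrite gt_eqF.
have tV : 1 <= t^-1 by rewrite invf_ge1// ltW.
have := @convex_powR R t^-1 tV (Itv01 s0 s1) (b `^ t) (a `^ t).
rewrite !inE/= !in_itv/= !powR_ge0 => /(_ isT isT).
rewrite !convRE/= /unstable.onem -!powRrM divff ?gt_eqF// !powRr1//.
have -> : s * b + (1 - s) * a = l by rewrite /s; field; rewrite gt_eqF.
move=> h; have w0 : 0 <= s * b `^ t + (1 - s) * a `^ t.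
  by rewrite addr_ge0// mulr_ge0 ?powR_ge0// subr_ge0.
rewrite -[leLHS]powRr1// -[X in _ `^ X <= _](@mulVf _ t) ?gt_eqF// powRrM.
by rewrite ge0_ler_powR// ?nnegrE ?powR_ge0 ?ltW.
Qed.

(** For a < b and 0 < t < 1, al * l + be is the chord of l^t through a and b. With X = al / t and Y
    = be / (1 - t), weighted AM-GM gives al g + be = t (X g) + (1 - t) Y >= (X g)^t Y^(1 - t) = Y (X
    / Y)^t g^t, and Y (X / Y)^t is the Kantorovich constant. *)
Lemma kantorovich_chord a b t : 0 < a -> a <= b -> 0 <= t <= 1 ->
  0 < kantorovich a b t /\
  exists al be, (forall l, a <= l <= b -> al * l + be <= l `^ t) /\
   (forall g, a <= g <= b -> kantorovich a b t * g `^ t <= al * g + be).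
Proof.
move=> a0 ab /andP[t0 t1]; rewrite /kantorovich.
have [->|tn0] /= := eqVneq t 0.
  split=> //; exists 0, 1; split=> l _; rewrite ?powRr0; lra.
have [->|tn1] /= := eqVneq t 1.
  split=> //; exists 1, 0; split=> l /andP[al _].
    by rewrite powRr1 ?(le_trans (ltW a0))// mul1r addr0.
  by rewrite powRr1 ?(le_trans (ltW a0))// mul1r addr0.
have [<-|anb] /= := eqVneq a b.
  split=> //; exists 0, (a `^ t); split=> l /le_anti <-; lra.
have {}ab : a < b by rewrite lt_neqAle anb.
have {}t0 : 0 < t by rewrite lt_neqAle eq_sym tn0.
have {}t1 : t < 1 by rewrite lt_neqAle tn1.
have b0 := lt_trans a0 ab.
have ba : 0 < b - a by rewrite subr_gt0.
have t10 : 0 < 1 - t by rewrite subr_gt0.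
set at_ := a `^ t; set bt := b `^ t.
have abt : at_ < bt by rewrite gt0_ltr_powR// nnegrE ltW.
(* The intercept of the chord is positive: this is a^(1 - t) < b^(1 - t) multiplied by a^t b^t. *)
have beta0 : 0 < b * at_ - a * bt.
  rewrite subr_gt0.
  have -> : b * at_ = b `^ t * a `^ t * b `^ (1 - t).
    by rewrite mulrAC -powRD ?(gt_eqF b0) ?implybT// addrC subrK powRr1// ltW.
  have -> : a * bt = b `^ t * a `^ t * a `^ (1 - t).
    by rewrite -mulrA -powRD ?(gt_eqF a0) ?implybT// addrC subrK powRr1 1?mulrC// ltW.
  by rewrite ltr_pM2l ?mulr_gt0 ?powR_gt0// gt0_ltr_powR// nnegrE ltW.
have t1n : t - 1 != 0 by rewrite subr_eq0.
have bn : a * bt - b * at_ != 0 by rewrite -oppr_eq0 opprB gt_eqF.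
pose al := (bt - at_) / (b - a); pose be := (b * at_ - a * bt) / (b - a).
have al0 : 0 < al by rewrite divr_gt0// subr_gt0.
have be0 : 0 < be by rewrite divr_gt0.
have -> : (a * bt - b * at_) / ((t - 1) * (b - a)) = be / (1 - t).
  by rewrite /be; field; rewrite t1n !gt_eqF.
have -> : (t - 1) / t * ((bt - at_) / (a * bt - b * at_)) =
    (al / t) / (be / (1 - t)).
  by rewrite /be /al; field; rewrite ?t1n ?bn ?gt_eqF.
set X := al / t; set Y := be / (1 - t).
have X0 : 0 < X by rewrite divr_gt0.
have Y0 : 0 < Y by rewrite divr_gt0.
split; first by apply: mulr_gt0 => //; apply: powR_gt0; apply: divr_gt0.
have t01 : 0 < t < 1 by rewrite t0.
exists al, be; split=> [l lab|g /andP[ag gb]]; first exact: le_powR_chord.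
have g0 : 0 < g := lt_le_trans a0 ag.
have [[g0' X0'] [Y0' YV0]] : (0 <= g /\ 0 <= X) /\ (0 <= Y /\ 0 <= Y^-1).
  by rewrite invr_ge0 !ltW.
have -> : Y * (X / Y) `^ t * g `^ t = (X * g) `^ t * Y `^ (1 - t).
  rewrite powRB ?(gt_eqF Y0) ?implybT// powRr1// (powRM t X0' YV0) (powRM t X0' g0').
  have -> : Y^-1 `^ t = (Y `^ t)^-1.
    by rewrite -(powR_inv1 Y0') -powRrM mulN1r powRN.
  by ring.
apply: le_trans (powR_AMGM t01 (mulr_ge0 X0' g0') Y0') _.
rewrite /X /Y le_eqVlt; apply/orP; left; apply/eqP; field.
by rewrite !gt_eqF.
Qed.

End Kantorovich.

(** * The real inner product of a complex Hilbert space *)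

(** Source of every Cauchy-Schwarz inequality below, the polynomial being the value of a
    semi-definite form at x + s y. The case c = 0 is included, so the form may degenerate. *)
Lemma discriminant_le0 (R : realFieldType) (a b c : R) :
  (forall s, 0 <= a + 2 * s * b + s ^+ 2 * c) -> b ^+ 2 <= a * c.
Proof.
move=> h; have a0 : 0 <= a by have := h 0; rewrite expr2 !(mulr0, mul0r) !addr0.
have [c0|c0] := eqVneq c 0.
  have [->|b0] := eqVneq b 0; first by rewrite expr2 mul0r c0 mulr0.
  (* With c = 0 the polynomial is linear and takes the value -1 here. *)
  have := h (- (a + 1) / (2 * b)).
  have -> : a + 2 * (- (a + 1) / (2 * b)) * b + (- (a + 1) / (2 * b)) ^+ 2 * c = -1.
    by rewrite c0; field; rewrite b0.
  lra.
have := h (- b / c).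
have -> : a + 2 * (- b / c) * b + (- b / c) ^+ 2 * c = a - b ^+ 2 / c.
  by field.
have c_gt0 : 0 < c.
  (* If c < 0, the values at 1 and -1 give - c <= a, so the s below exceeds 1, while the value at s
     is at most a - s (a + 1) < 0. *)
  rewrite lt_neqAle eq_sym c0 leNgt /=; apply/negP => cl.
  have := h (((b ^+ 2 + (a + 1) ) + 1)/ - c).
  set s := _ / _.
  have sc : s * c = - (b ^+ 2 + a + 2) by rewrite /s; field.
  have s0 : 0 <= s by rewrite divr_ge0 ?oppr_ge0 ?(ltW cl)//; nra.
  have := h 1; have := h (-1); nra.
by rewrite subr_ge0 ler_pdivrMr.
Qed.

Section RealInnerProduct.
Variables (R : realType) (H : completeNormedModType R[i]).
Variable dot : {dot H for Num.conj}.
Hypothesis hdot : is_inner_product dot.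
Implicit Types (x y z : H) (a c : R).

(** The real part makes H a real inner product space with the same norm; estimates then live in R,
    within reach of [lra] and [nra]. *)
Definition rdot x y : R := complex.Re (dot x y).
Definition rnorm x : R := complex.Re `|x|.

Lemma Re_add (u v : R[i]) : complex.Re (u + v) = complex.Re u + complex.Re v.
Proof. by case: u v => [? ?] [? ?]. Qed.

Lemma Re_opp (u : R[i]) : complex.Re (- u) = - complex.Re u.
Proof. by case: u. Qed.

Lemma Re_realM a (u : R[i]) : complex.Re (a%:C * u) = a * complex.Re u.
Proof. by case: u => ? ? /=; rewrite mul0r subr0. Qed.

Lemma Re_conj (u : R[i]) : complex.Re (u^*)%R = complex.Re u.
Proof. by case: u. Qed.

Lemma conj_real a : (a%:C)^*%R = a%:C.
Proof. by apply/CrealP; rewrite complex_real. Qed.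

Lemma rdotDl x y z : rdot (x + y) z = rdot x z + rdot y z.
Proof. by rewrite /rdot linearDl Re_add. Qed.

Lemma rdotDr x y z : rdot x (y + z) = rdot x y + rdot x z.
Proof. by rewrite /rdot linearDr Re_add. Qed.

Lemma rdotNl x y : rdot (- x) y = - rdot x y.
Proof. by rewrite /rdot linearNl Re_opp. Qed.

Lemma rdotNr x y : rdot x (- y) = - rdot x y.
Proof. by rewrite /rdot linearNr Re_opp. Qed.

Lemma rdotZl a x y : rdot (a%:C *: x) y = a * rdot x y.
Proof. by rewrite /rdot linearZl_LR Re_realM. Qed.

Lemma rdotZr a x y : rdot x (a%:C *: y) = a * rdot x y.
Proof. by rewrite /rdot linearZr_LR /= conj_real Re_realM. Qed.

Lemma rdotC x y : rdot x y = rdot y x.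
Proof. by rewrite /rdot hermC expr0 mul1r Re_conj. Qed.

Definition rdotE := (rdotDl, rdotDr, rdotNl, rdotNr, rdotZl, rdotZr).

Lemma rnormE x : (rnorm x)%:C = `|x|.
Proof. by apply: RRe_real; apply: ger0_real. Qed.

Lemma rnorm_ge0 x : 0 <= rnorm x.
Proof. by rewrite -ler0c rnormE. Qed.

Lemma sqr_rnorm x : rnorm x ^+ 2 = rdot x x.
Proof. by rewrite /rdot -hdot -rnormE -rmorphXn. Qed.

Lemma rdot_ge0 x : 0 <= rdot x x.
Proof. by rewrite -sqr_rnorm sqr_ge0. Qed.

Lemma ler_rnormD x y : rnorm (x + y) <= rnorm x + rnorm y.
Proof.
rewrite -lecR [X in _ <= X](rmorphD (real_complex R)) /= !rnormE.
exact: ler_normD.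
Qed.

Lemma rnormN x : rnorm (- x) = rnorm x.
Proof. by rewrite /rnorm normrN. Qed.

Lemma rnormZc (l : R[i]) x : rnorm (l *: x) = complex.Re `|l| * rnorm x.
Proof.
by rewrite /rnorm normrZ -(rnormE x) -[`|l|]RRe_real ?ger0_real//= !mul0r subr0.
Qed.

Lemma rnormZ a x : rnorm (a%:C *: x) = `|a| * rnorm x.
Proof. by rewrite rnormZc normc_def /= expr0n addr0 sqrtr_sqr. Qed.

Lemma rnorm0 : rnorm 0 = 0.
Proof. by rewrite /rnorm normr0. Qed.

Lemma rnorm_eq0 x : rnorm x = 0 -> x = 0.
Proof. by move=> h; apply/normr0_eq0; rewrite -rnormE h. Qed.

Lemma rdot_CauchySchwarz x y : rdot x y <= rnorm x * rnorm y.
Proof.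
apply: le_trans (ler_norm _) _.
rewrite -ler_sqr ?nnegrE ?mulr_ge0 ?rnorm_ge0// real_normK ?num_real// exprMn.
rewrite !sqr_rnorm; apply: discriminant_le0 => s.
have := rdot_ge0 (x + s%:C *: y); rewrite !rdotE (rdotC y x); lra.
Qed.

Lemma eq0_of_rnorm_le x : (forall e, 0 < e -> rnorm x <= e) -> x = 0.
Proof.
move=> h; apply: rnorm_eq0; apply/le_anti; rewrite rnorm_ge0 andbT.
apply/ler_addgt0Pl => e /h; by rewrite addr0.
Qed.

(** Letting m tend to infinity in the second hypothesis keeps the error bound d n for the limit. *)
Lemma rnorm_cauchy (u : nat -> H) (d : nat -> R) :
  (forall e, 0 < e -> exists n0, forall n, (n0 <= n)%N -> d n <= e) ->
  (forall n m, rnorm (u n - u m) <= d n + d m) ->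
  exists l, forall n, rnorm (u n - l) <= d n.
Proof.
move=> d0 hu.
have /cauchy_cvgP/cvg_ex[l /= hl] : cauchy (u @ \oo)%classic.
  apply: cauchy_exP => e e0.
  (* Radii of balls are elements of R[i]; a positive one is real. *)
  have er : (complex.Re e)%:C = e by apply: RRe_real; apply: gtr0_real.
  have er0 : 0 < complex.Re e by rewrite -ltcR er.
  have [n0 hn0] := d0 (complex.Re e / 4) (divr_gt0 er0 (ltr0Sn _ _)).
  exists (u n0); exists n0 => // n /= n0n.
  rewrite -ball_normE /ball_ /= -rnormE -er ltcR.
  apply: le_lt_trans (hu _ _) _.
  by have := hn0 _ (leqnn _); have := hn0 _ n0n; lra.
exists l => n; apply/ler_addgt0Pl => e e0.
have [n0 hn0] := d0 (e / 2) (divr_gt0 e0 (ltr0Sn _ _)).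
have e02 : 0 < (e / 2)%:C :> R[i] by rewrite ltcR divr_gt0.
have /cvgrPdist_le/(_ _ e02)[n1 _ hn1] := hl.
pose k := maxn n0 n1.
have h1 := hn1 k (leq_maxr _ _); rewrite /= -rnormE lecR in h1.
have h0 := hn0 k (leq_maxl _ _).
have -> : u n - l = (u n - u k) - (l - u k) by rewrite opprB addrA subrK.
apply: le_trans (ler_rnormD _ _) _; rewrite rnormN.
have := hu n k; lra.
Qed.

End RealInnerProduct.

(** * Polynomials of self-adjoint operators *)

Section PolynomialCalculus.
Variables (K : fieldType) (V : lmodType K).
Implicit Types (p q : {poly K}) (T : V -> V) (x y : V).

Lemma linear_op0 T : linear T -> T 0 = 0.
Proof. by move=> hT; have := hT (-1) 0 0; rewrite scaleN1r oppr0 addr0 scaleN1r addNr. Qed.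

Lemma linear_opD T (hT : linear T) x y : T (x + y) = T x + T y.
Proof. by have := hT 1 x y; rewrite !scale1r. Qed.

Lemma linear_opZ T (hT : linear T) a x : T (a *: x) = a *: T x.
Proof. by have := hT a x 0; rewrite (linear_op0 hT) !addr0. Qed.

Lemma linear_opN T (hT : linear T) x : T (- x) = - T x.
Proof. by rewrite -scaleN1r (linear_opZ hT) scaleN1r. Qed.

Lemma linear_opB T (hT : linear T) x y : T (x - y) = T x - T y.
Proof. by rewrite (linear_opD hT) (linear_opN hT). Qed.

(** Complex counterpart of [poly_op]: a real polynomial splits into linear factors only over the
    complex numbers. *)
Definition evalp q T x : V := \sum_(i < size q) q`_i *: iter i T x.

Lemma evalp_widen q T x n : (size q <= n)%N ->
  evalp q T x = \sum_(i < n) q`_i *: iter i T x.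
Proof.
move=> qn; rewrite /evalp (big_ord_widen _ (fun i => q`_i *: iter i T x) qn).
rewrite big_mkcond; apply: eq_bigr => i _; case: ltnP => // h.
by rewrite nth_default// scale0r.
Qed.

Lemma evalpD p q T x : evalp (p + q) T x = evalp p T x + evalp q T x.
Proof.
pose n := maxn (size p) (size q).
rewrite !(@evalp_widen _ T x n) ?leq_maxl ?leq_maxr ?size_polyD//.
by rewrite -big_split; apply: eq_bigr => i _; rewrite coefD scalerDl.
Qed.

Lemma evalpZ a p T x : evalp (a *: p) T x = a *: evalp p T x.
Proof.
rewrite !(@evalp_widen _ T x (size p)) ?size_scale_leq// scaler_sumr.
by apply: eq_bigr => i _; rewrite coefZ scalerA.
Qed.

Lemma evalpN p T x : evalp (- p) T x = - evalp p T x.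
Proof. by rewrite -[- p]scaleN1r evalpZ scaleN1r. Qed.

Lemma evalpC a T x : evalp a%:P T x = a *: x.
Proof. by rewrite (@evalp_widen _ T x 1) ?size_polyC_leq1// big_ord1 coefC. Qed.

Lemma evalp_mulX p T x : evalp (p * 'X) T x = evalp p T (T x).
Proof.
rewrite (@evalp_widen _ T x (size p).+1); last first.
  have [->|p0] := eqVneq p 0; first by rewrite mul0r size_poly0.
  by rewrite size_mulX.
rewrite big_ord_recl coefMX eqxx scale0r add0r.
by apply: eq_bigr => i _; rewrite !lift0 coefMX -iterSr.
Qed.

Lemma evalpX T x : evalp 'X T x = T x.
Proof. by rewrite -['X]mul1r evalp_mulX evalpC scale1r. Qed.

Lemma evalp_linear p T : linear T -> linear (evalp p T).
Proof.
move=> hT; elim/poly_ind: p => [|p c IHp] a x y.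
  by rewrite -polyC0 !evalpC !scale0r scaler0 addr0.
rewrite !evalpD !evalp_mulX !evalpC hT IHp !scalerDr !scalerA (mulrC c a).
by rewrite addrACA.
Qed.

Lemma evalp_comm p T x : linear T -> evalp p T (T x) = T (evalp p T x).
Proof.
move=> hT; elim/poly_ind: p x => [|p c IHp] x.
  by rewrite -polyC0 !evalpC !scale0r (linear_op0 hT).
by rewrite !evalpD !evalp_mulX !evalpC IHp (linear_opD hT) (linear_opZ hT).
Qed.

Lemma evalpM p q T x : linear T -> evalp (p * q) T x = evalp p T (evalp q T x).
Proof.
move=> hT; elim/poly_ind: p x => [|p c IHp] x.
  by rewrite mul0r -polyC0 !evalpC !scale0r.
rewrite mulrDl evalpD -mulrA (mulrC 'X) mulrA evalp_mulX IHp evalp_comm//.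
by rewrite mul_polyC evalpZ evalpD evalp_mulX evalpC.
Qed.

End PolynomialCalculus.

Section SelfAdjoint.
Variables (R : realType) (H : completeNormedModType R[i]).
Variable dot : {dot H for Num.conj}.
Hypothesis hdot : is_inner_product dot.
Implicit Types (x y : H) (a c : R) (T Y S : H -> H) (p q : {poly R}).
Local Notation rdot := (rdot dot).

Lemma Im_conj (u : R[i]) : complex.Im (u^*)%R = - complex.Im u.
Proof. by case: u. Qed.

Lemma poly_opE p T x : poly_op p T x = evalp (map_poly (real_complex R) p) T x.
Proof. by rewrite /poly_op /evalp size_map_poly; apply: eq_bigr => i _; rewrite coef_map. Qed.

Lemma poly_opD p q T x : poly_op (p + q) T x = poly_op p T x + poly_op q T x.
Proof. by rewrite !poly_opE rmorphD evalpD. Qed.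

Lemma poly_opN p T x : poly_op (- p) T x = - poly_op p T x.
Proof. by rewrite !poly_opE rmorphN evalpN. Qed.

Lemma poly_opB p q T x : poly_op (p - q) T x = poly_op p T x - poly_op q T x.
Proof. by rewrite poly_opD poly_opN. Qed.

Lemma poly_opC a T x : poly_op a%:P T x = a%:C *: x.
Proof. by rewrite poly_opE map_polyC evalpC. Qed.

Lemma poly_opX T x : poly_op 'X T x = T x.
Proof. by rewrite poly_opE map_polyX evalpX. Qed.

Lemma poly_opM p q T x : linear T ->
  poly_op (p * q) T x = poly_op p T (poly_op q T x).
Proof. by move=> hT; rewrite !poly_opE rmorphM evalpM// . Qed.

Lemma poly_opZ a p T x : poly_op (a *: p) T x = a%:C *: poly_op p T x.
Proof. by rewrite !poly_opE map_polyZ evalpZ. Qed.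

Lemma poly_op_linear p T : linear T -> linear (poly_op p T).
Proof. by move=> hT a x y; rewrite !poly_opE evalp_linear. Qed.

Definition poly_opW := (poly_opD, poly_opN, poly_opC, poly_opX, poly_opZ).

Lemma bounded_opP T : bounded_op T <->
  linear T /\ exists2 c, 0 < c & forall x, rnorm (T x) <= c * rnorm x.
Proof.
split=> -[hT [c]] => [hc|c0 hc]; split => //.
  exists (`|c| + 1) => [|x]; first by rewrite ltr_wpDl.
  have := hc x; rewrite -!rnormE -rmorphM lecR => /le_trans; apply.
  rewrite ler_wpM2r ?rnorm_ge0//; have := ler_norm c; lra.
by exists c => x; rewrite -!rnormE -rmorphM lecR.
Qed.

Lemma bounded_linear T : bounded_op T -> linear T.
Proof. by case. Qed.

Lemma bounded_cst a : bounded_op (fun x : H => a%:C *: x).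
Proof.
apply/bounded_opP; split=> [b x y|].
  by rewrite scalerDr !scalerA mulrC.
exists (`|a| + 1) => [|x]; first by rewrite ltr_wpDl.
by rewrite rnormZ ler_wpM2r ?rnorm_ge0//; lra.
Qed.

Lemma bounded_add T S : bounded_op T -> bounded_op S ->
  bounded_op (fun x => T x + S x).
Proof.
move=> /bounded_opP[lT [c c0 hc]] /bounded_opP[lS [d d0 hd]].
apply/bounded_opP; split=> [a x y|]; first by rewrite lT lS scalerDr addrACA.
exists (c + d) => [|x]; first exact: addr_gt0.
by apply: le_trans (ler_rnormD _ _) _; rewrite mulrDl lerD.
Qed.

Lemma bounded_comp T S : bounded_op T -> bounded_op S -> bounded_op (T \o S).
Proof.
move=> /bounded_opP[lT [c c0 hc]] /bounded_opP[lS [d d0 hd]].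
apply/bounded_opP; split=> [a x y /=|]; first by rewrite lS lT.
exists (c * d) => [|x]; first exact: mulr_gt0.
by apply: le_trans (hc _) _; rewrite -mulrA ler_wpM2l// ltW.
Qed.

Lemma bounded_subZ T a : bounded_op T -> bounded_op (fun x => T x - a%:C *: x).
Proof.
move=> bT; have := bounded_add bT (bounded_cst (- a)).
by congr bounded_op; apply/funext => x; rewrite rmorphN scaleNr.
Qed.

Lemma bounded_poly p T : bounded_op T -> bounded_op (poly_op p T).
Proof.
move=> bT; elim/poly_ind: p => [|p c IHp].
  by have := bounded_cst 0; congr bounded_op; apply/funext => x; rewrite -(poly_opC 0 T).
have := bounded_add (bounded_comp IHp bT) (bounded_cst c).
congr bounded_op; apply/funext => x.
by rewrite poly_opD poly_opM ?poly_opX ?poly_opC//; apply: bounded_linear.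
Qed.

Definition rsymmetric T := forall x y, rdot (T x) y = rdot x (T y).

Lemma self_adjoint_rsym T : self_adjoint dot T -> rsymmetric T.
Proof. by move=> h x y; rewrite /rdot h. Qed.

(* The imaginary part of an inner product is the real part of another one. *)
Lemma rsym_self_adjoint T : linear T -> rsymmetric T -> self_adjoint dot T.
Proof.
move=> lT h x y; have h1 := h x y; have h2 := h ('i%C *: x) y; move: h1 h2.
rewrite /rdot (linear_opZ lT) !linearZl_LR /= !(mulrC 'i%C) !ReiNIm.
case: (dot (T x) y) (dot x (T y)) => [u v] [u' v'] /= -> /oppr_inj -> //.
Qed.

Lemma rsym_subZ T a : rsymmetric T -> rsymmetric (fun x => T x - a%:C *: x).
Proof. by move=> h x y; rewrite !rdotE h. Qed.

Lemma rsym_poly p T : linear T -> rsymmetric T -> rsymmetric (poly_op p T).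
Proof.
move=> lT h; elim/poly_ind: p => [|p c IHp] x y.
  by rewrite -polyC0 !poly_opC !rdotE !mul0r.
rewrite !poly_opD !rdotE !poly_opC !rdotE; congr (_ + _).
by rewrite poly_opM// (mulrC p) poly_opM// !poly_opX IHp h.
Qed.

Definition lower_bound c T := forall x, c * rdot x x <= rdot (T x) x.

(** Replaces invertibility in the spectral arguments: it follows from a bounded inverse and passes
    to compositions. *)
Definition bounded_below T :=
  exists2 k, 0 < k & forall x, k * rnorm x <= rnorm (T x).

(** Cauchy-Schwarz for the form <T ., .> at x and T x gives |T x|^4 <= <T x, x> <T (T x), T x> <= <T
    x, x> c |T x|^2; then divide by |T x|^2. *)
Lemma lower_bound_sqr T c x : rsymmetric T -> lower_bound 0 T -> linear T ->
  (forall y, rnorm (T y) <= c * rnorm y) ->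
  rnorm (T x) ^+ 2 <= c * rdot (T x) x.
Proof.
move=> sT T0 lT Tc.
have T_ge0 y : 0 <= rdot (T y) y by have := T0 y; rewrite mul0r.
have CS y : rdot (T x) y ^+ 2 <= rdot (T x) x * rdot (T y) y.
  apply: discriminant_le0 => s; have := T_ge0 (x + s%:C *: y).
  rewrite (linear_opD lT) (linear_opZ lT) !rdotE (sT y x) (rdotC _ y (T x)).
  lra.
have := CS (T x); rewrite -!(sqr_rnorm hdot).
have : rdot (T (T x)) (T x) <= c * rnorm (T x) ^+ 2.
  apply: le_trans (rdot_CauchySchwarz hdot _ _) _.
  by rewrite expr2 mulrA ler_wpM2r ?rnorm_ge0.
(* If T x = 0, the right side must be nonnegative: either x = 0, or the norm bound forces c >= 0. *)
have [->|n0] := eqVneq (rnorm (T x)) 0.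
  move=> _ _; rewrite expr0n/=.
  have [/eqP|n0] := eqVneq (rnorm x) 0.
    by move=> /eqP/rnorm_eq0 ->; rewrite (linear_op0 lT) /rdot linear0l mulr0.
  rewrite mulr_ge0//; have := Tc x; have := rnorm_ge0 (T x).
  by move=> /le_trans/[apply]; rewrite pmulr_lge0// lt_neqAle eq_sym n0 rnorm_ge0.
have : 0 < rnorm (T x) ^+ 2 by rewrite exprn_gt0// lt_neqAle eq_sym n0 rnorm_ge0.
have := T_ge0 x; set n := rnorm _ ^+ 2; set q := rdot (T x) x; set r := rdot _ _ => q0 n1 h1 h2.
rewrite -(ler_pM2r n1); nra.
Qed.

(* The infimum of the numerical range is an approximate eigenvalue. *)
Lemma lower_bound_crit Y a : bounded_op Y -> rsymmetric Y ->
  (forall c, c < a -> bounded_below (fun x => Y x - c%:C *: x)) ->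
  lower_bound a Y.
Proof.
move=> bY sY hY; have [lY [C C0 hC]] := (bounded_opP Y).1 bY.
apply: contrapT => /existsNP[x /negP]; rewrite -ltNge => xa.
have x0 := rdot_ge0 hdot x.
pose L : set R := [set c | lower_bound c Y]%classic.
have Lub c : L c -> c < a.
  by move=> /(_ x) h; rewrite ltNge; apply/negP => ac; nra.
have L0 : L (- C).
  move=> y; have := rdot_CauchySchwarz hdot (Y y) (- y).
  rewrite rnormN rdotE -(sqr_rnorm hdot).
  have := hC y; have := rnorm_ge0 y; nra.
have supL : has_sup L.
  by split; [exists (- C) | exists a => c /Lub/ltW].
set s := sup L.
have Ls : L s.
  move=> y; have := rdot_ge0 hdot y; rewrite le_eqVlt => /predU1P[y0|y0].
    by have := L0 y; rewrite -y0 !mulr0.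
  rewrite -ler_pdivlMr//; apply: ge_sup; first exact: supL.1.
  by move=> c /(_ y); rewrite ler_pdivlMr.
have [k k0 hk] := hY s (Lub _ Ls).
have [lZ [D D0 hD]] := (bounded_opP _).1 (bounded_subZ s bY).
(* Y - s is nonnegative and bounded below by k, so k^2 |y|^2 <= |(Y - s) y|^2 <= D <(Y - s) y, y>:
   the supremum s could be raised by k^2 / D. *)
have : L (s + k ^+ 2 / D).
  move=> y; have := @lower_bound_sqr _ D y (rsym_subZ s sY) _ lZ hD.
  have Z0 : lower_bound 0 (fun x => Y x - s%:C *: x).
    by move=> z; have := Ls z; rewrite mul0r !rdotE subr_ge0.
  move=> /(_ Z0); rewrite !rdotE => h.
  have h2 : k ^+ 2 * rdot y y <= rnorm (Y y - s%:C *: y) ^+ 2.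
    by rewrite -(sqr_rnorm hdot) -exprMn lerXn2r ?nnegrE ?mulr_ge0 ?rnorm_ge0 ?(ltW k0).
  have := le_trans h2 h; rewrite -ler_pdivrMl//.
  rewrite mulrDl; lra.
move=> /(sup_ubound supL.2); rewrite -/s.
have : 0 < k ^+ 2 / D by rewrite divr_gt0// exprn_gt0.
lra.
Qed.

Lemma bounded_below_comp T S :
  bounded_below T -> bounded_below S -> bounded_below (T \o S).
Proof.
move=> [k k0 hk] [l l0 hl]; exists (k * l) => [|x]; first exact: mulr_gt0.
by apply: le_trans (hk _); rewrite -mulrA ler_wpM2l// ltW.
Qed.

Lemma lower_bound_bounded_below T c : 0 < c -> lower_bound c T -> bounded_below T.
Proof.
move=> c0 h; exists c => // x; have := h x; have := rdot_CauchySchwarz hdot (T x) x.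
rewrite -(sqr_rnorm hdot); have := rnorm_ge0 x; rewrite le_eqVlt => /predU1P[<- _ _|x0].
  by rewrite mulr0 rnorm_ge0.
by move=> h1 h2; have := le_trans h2 h1; rewrite expr2 mulrA ler_pM2r.
Qed.

(* For z off the real line Im <(T - z) x, x> = - Im z |x|^2. *)
Lemma bounded_below_nonreal T (z : R[i]) : rsymmetric T -> linear T ->
  complex.Im z != 0 -> bounded_below (fun x => T x - z *: x).
Proof.
move=> /rsym_self_adjoint sT lT; case: z => a b /= b0.
exists `|b| => [|x]; first by rewrite normr_gt0.
have e : rdot (T x - (a +i* b) *: x) ('i%C *: x) = - b * rdot x x.
  rewrite /rdot linearBl linearZl_LR linearZr_LR /=.
  rewrite linearZr_LR /=.
  have : complex.Im (dot (T x) x) = 0.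
    have := congr1 (@complex.Im R) (sT lT x x).
    rewrite [in RHS]hermC expr0 mul1r Im_conj => /eqP.
    by rewrite -subr_eq0 opprK -mulr2n mulrn_eq0 => /eqP.
  have : complex.Im (dot x x) = 0.
    by rewrite -hdot -rnormE -rmorphXn.
  case: (dot (T x) x) (dot x x) => u v [u' v'] /= -> ->.
  by rewrite !(mul0r, mulr0, mul1r, add0r, addr0, oppr0, mulrN, opprK, subr0, sub0r, mulNr, mulr1).
have [x0|x0] := eqVneq (rnorm x) 0; first by rewrite x0 mulr0 rnorm_ge0.
have {}x0 : 0 < rnorm x by rewrite lt_neqAle eq_sym x0 rnorm_ge0.
have ri : rnorm ('i%C *: x) = rnorm x.
  by rewrite rnormZc normc_def /= expr0n add0r expr1n sqrtr1 mul1r.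
have h1 := rdot_CauchySchwarz hdot (T x - (a +i* b) *: x) ('i%C *: x).
have h2 := rdot_CauchySchwarz hdot (- (T x - (a +i* b) *: x)) ('i%C *: x).
move: h1 h2; rewrite rdotNl e rnormN ri -(sqr_rnorm hdot) => h1 h2.
rewrite -(ler_pM2r x0); have [_|_] := ger0P b; nra.
Qed.

(** A free set E serves both the real spectrum and an interval known only from bounds on the
    quadratic form. *)
Definition resolvent_bound (E : R -> Prop) T :=
  forall r, ~ E r -> bounded_below (fun x => T x - r%:C *: x).

(** By [lower_bound_crit] it suffices that p(T) - d is bounded below for d < c. Over the complex
    numbers it is a nonzero scalar times a product of factors T - z, unless p = d. A real root z has
    p(z) = d < c, hence lies outside E; a nonreal one is covered by [bounded_below_nonreal]. *)
Lemma lower_bound_poly (E : R -> Prop) T p c :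
  bounded_op T -> rsymmetric T -> resolvent_bound E T ->
  (forall l, E l -> c <= p.[l]) -> lower_bound c (poly_op p T).
Proof.
move=> bT sT hE hp; have lT := bounded_linear bT.
apply: lower_bound_crit => [||d dc]; [exact: bounded_poly|exact: rsym_poly|].
set Y := fun x => _.
pose q := p - d%:P.
have YE x : Y x = evalp (map_poly (real_complex R) q) T x.
  by rewrite -poly_opE poly_opB poly_opC.
(* If p is the constant d < c, then E is empty; [lower_bound_crit] makes every real number a lower
   bound of T, which forces x = 0. *)
have [q0|q0] := eqVneq q 0.
  have E0 l : ~ E l.
    by move=> /hp; have -> : p = d%:P; [apply/subr0_eq|rewrite hornerC leNgt dc].
  exists 1 => // x; suff -> : x = 0 by rewrite rnorm0 mulr0 rnorm_ge0.
  suff : rdot x x = 0.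
    by rewrite -(sqr_rnorm hdot) => /eqP; rewrite expf_eq0 => /eqP/rnorm_eq0.
  have := @lower_bound_crit T (rdot (T x) x / rdot x x + 1) bT sT (fun c _ => hE c (E0 c)) x.
  have [//|xx] := eqVneq (rdot x x) 0.
  have := rdot_ge0 hdot x; rewrite mulrDl divfK// le_eqVlt eq_sym (negPf xx) /=.
  lra.
suff : bounded_below (evalp (map_poly (real_complex R) q) T).
  by move=> [k k0 hk]; exists k => // x; rewrite YE.
have [r qr] := closed_field_poly_normal (map_poly (real_complex R) q).
have lq : lead_coef (map_poly (real_complex R) q) != 0.
  by rewrite lead_coef_eq0 map_poly_eq0.
have : forall z, z \in r -> bounded_below (evalp ('X - z%:P) T).
  move=> z zr.
  suff : bounded_below (fun x => T x - z *: x).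
    by move=> [k k0 hk]; exists k => // x; rewrite evalpD evalpN evalpX evalpC.
  have [z0|] := eqVneq (complex.Im z) 0; last exact: bounded_below_nonreal.
  have zR : z = (complex.Re z)%:C by case: (z) z0 => u v /= ->.
  rewrite zR; apply: hE => /hp; apply/negP; rewrite -ltNge.
  have : root (map_poly (real_complex R) q) z.
    by rewrite qr rootZ// root_prod_XsubC.
  rewrite zR fmorph_root /root !hornerE subr_eq0 => /eqP ->; exact: dc.
rewrite qr; elim: r {qr} => [|z r IHr] hr.
  rewrite big_nil.
  exists (complex.Re `|lead_coef (map_poly (real_complex R) q)|).
    by rewrite -ltcR RRe_real ?normr_gt0// ger0_real.
  by move=> x; rewrite evalpZ -[1]/(1%:P) evalpC scale1r rnormZc.
rewrite big_cons scalerAr.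
have [||k k0 hk] := bounded_below_comp (hr z _) (IHr _).
- by rewrite mem_head.
- by move=> w wr; apply: hr; rewrite in_cons wr orbT.
by exists k => // x; rewrite evalpM//; apply: hk.
Qed.

(** On E one has e^2 - p^2 >= 0, and <p(T)^2 x, x> = |p(T) x|^2 by symmetry. *)
Lemma poly_op_norm (E : R -> Prop) T p e x :
  bounded_op T -> rsymmetric T -> resolvent_bound E T -> 0 <= e ->
  (forall l, E l -> `|p.[l]| <= e) -> rnorm (poly_op p T x) <= e * rnorm x.
Proof.
move=> bT sT hE e0 hp; have lT := bounded_linear bT.
rewrite -ler_sqr ?nnegrE ?mulr_ge0 ?rnorm_ge0// exprMn !(sqr_rnorm hdot).
have : lower_bound (- e ^+ 2) (poly_op (- (p * p)) T).
  apply: lower_bound_poly bT sT hE _ => l /hp; rewrite !hornerE.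
  rewrite ler_norml => /andP[]; nra.
move=> /(_ x); rewrite poly_opN poly_opM// rdotE rsym_poly//; lra.
Qed.

End SelfAdjoint.

(** * Continuous functional calculus *)

(** Restricting to e <= 1 lets products of two errors be absorbed in a bound linear in e. *)
Lemma le0_of_small (R : realFieldType) (u c : R) : 0 <= c ->
  (forall e, 0 < e <= 1 -> u <= e * c) -> u <= 0.
Proof.
move=> c0 h; rewrite leNgt; apply/negP => u0.
have cu : 0 < c + u by lra.
have := h (u / (2 * (c + u))).
rewrite divr_gt0 ?mulr_gt0// ler_pdivrMr ?mulr_gt0// => /(_ _)/implyP.
have -> : u <= 1 * (2 * (c + u)) by lra.
rewrite mulrAC ler_pdivlMr ?mulr_gt0//= => h2; nra.
Qed.

Section FunctionalCalculus.
Variables (R : realType) (H : completeNormedModType R[i]).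
Variable dot : {dot H for Num.conj}.
Hypothesis hdot : is_inner_product dot.
Implicit Types (x y : H) (a b c : R) (T Y S : H -> H) (p q : {poly R}).
Implicit Types (E : R -> Prop) (f g : R -> R).
Local Notation rdot := (rdot dot).
Local Notation rsymmetric := (rsymmetric dot).
Local Notation lower_bound := (lower_bound dot).

(** With E in place of the spectrum, f(T) can be built on an interval before the spectrum is located
    in it. *)
Definition fcalc_on E f T S : Prop := bounded_op S /\
  forall e : R, 0 < e -> exists p : {poly R},
    (forall l, E l -> `|p.[l] - f l| <= e) /\
    (forall x, rnorm (poly_op p T x - S x) <= e * rnorm x).

Definition real_spectrum T (l : R) : Prop := spectrum T l%:C.

Lemma is_fcalcE f T S : is_fcalc f T S <-> fcalc_on (real_spectrum T) f T S.
Proof.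
split=> -[bS h]; split=> // e /h[p [h1 h2]]; exists p; split=> // x;
  by have := h2 x; rewrite -!rnormE -rmorphM lecR.
Qed.

Lemma bounded_below_inverse T S : is_inverse T S -> bounded_below T.
Proof.
move=> [/bounded_opP[lS [c c0 hc]] ST TS]; exists c^-1 => [|x].
  by rewrite invr_gt0.
by rewrite ler_pdivrMl// -[x in rnorm x <= _]TS.
Qed.

Lemma resolvent_bound_spectrum T : resolvent_bound (real_spectrum T) T.
Proof. by move=> r /contrapT[S /bounded_below_inverse]. Qed.

Lemma fcalc_on_sub E E' f T S : (forall l, E l -> E' l) ->
  fcalc_on E' f T S -> fcalc_on E f T S.
Proof.
by move=> EE [bS h]; split=> // e /h[p [h1 h2]]; exists p; split=> // l /EE/h1.
Qed.

Lemma fcalc_on_poly E p T : bounded_op T ->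
  fcalc_on E (horner p) T (poly_op p T).
Proof.
move=> bT; split=> [|e e0]; first exact: bounded_poly.
exists p; split=> [l _|x]; first by rewrite subrr normr0 ltW.
by rewrite subrr rnorm0 mulr_ge0 ?rnorm_ge0// ltW.
Qed.

Lemma fcalc_on_rsym E f T S : linear T -> rsymmetric T ->
  fcalc_on E f T S -> rsymmetric S.
Proof.
move=> lT sT [bS h].
suff main x y : rdot (S x) y - rdot x (S y) <= 0.
  move=> x y; apply/le_anti; rewrite -subr_le0 main /=.
  by have := main y x; rewrite subr_le0 (rdotC _ y) (rdotC _ x).
apply: (@le0_of_small _ _ (2 * (rnorm x * rnorm y))).
  by rewrite !mulr_ge0 ?rnorm_ge0.
move=> e /andP[e0 _]; have [p [_ hp]] := h e e0.
have -> : rdot (S x) y - rdot x (S y) =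
    rdot (- (poly_op p T x - S x)) y + rdot x (poly_op p T y - S y).
  by rewrite !rdotE (rsym_poly p lT sT x y); ring.
have h1 := rdot_CauchySchwarz hdot (- (poly_op p T x - S x)) y.
have h2 := rdot_CauchySchwarz hdot x (poly_op p T y - S y).
rewrite rnormN in h1.
have := ler_wpM2r (rnorm_ge0 y) (hp x).
have := ler_wpM2l (rnorm_ge0 x) (hp y).
lra.
Qed.

Section SelfAdjointOperator.
Variables (E : R -> Prop) (T : H -> H).
Hypotheses (bT : bounded_op T) (sT : rsymmetric T) (hE : resolvent_bound E T).
Let lT : linear T := bounded_linear bT.

(** An approximant p of f satisfies p - q >= - e on E, so [lower_bound_poly] applies to p - q; then
    e tends to 0. *)
Lemma fcalc_on_ge f S q x : fcalc_on E f T S ->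
  (forall l, E l -> q.[l] <= f l) -> rdot (poly_op q T x) x <= rdot (S x) x.
Proof.
move=> [bS h] qf; rewrite -subr_le0.
apply: (@le0_of_small _ _ (2 * (rnorm x * rnorm x))).
  by rewrite !mulr_ge0 ?rnorm_ge0.
move=> e /andP[e0 _]; have [p [hp1 hp2]] := h e e0.
have : lower_bound (- e) (poly_op (p - q) T).
  apply: (lower_bound_poly hdot bT sT hE) => l El; rewrite !hornerE.
  by have := hp1 l El; have := qf l El; rewrite ler_norml => ? /andP[]; lra.
move=> /(_ x); rewrite poly_opB !rdotE -(sqr_rnorm hdot).
have := rdot_CauchySchwarz hdot (poly_op p T x - S x) x.
have := ler_wpM2r (rnorm_ge0 x) (hp2 x).
rewrite !rdotE; lra.
Qed.

(** If p and r approximate f and g, then p r - q is small on E, hence in operator norm. Products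
    that are polynomials suffice for inverses and square roots. *)
Lemma fcalc_on_mul f g S S' q C : 0 <= C ->
  fcalc_on E f T S -> fcalc_on E g T S' ->
  (forall l, E l -> `|f l| <= C /\ `|g l| <= C) ->
  (forall l, E l -> f l * g l = q.[l]) ->
  forall x, S (S' x) = poly_op q T x.
Proof.
move=> C0 [bS hf] [/bounded_opP[lS' [D D0 hD]] hg] hC fg x.
apply/subr0_eq/rnorm_eq0/le_anti; rewrite rnorm_ge0 andbT.
(* The three errors below are (2 C + 1) e, (C + 1) e and D e, each times |x|. *)
apply: (@le0_of_small _ _ ((3 * C + 2 + D) * rnorm x)).
  by rewrite mulr_ge0 ?rnorm_ge0//; lra.
move=> e /andP[e0 e1].
have [p [hp1 hp2]] := hf e e0; have [r [hr1 hr2]] := hg e e0.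
have pC l : E l -> `|p.[l]| <= C + 1.
  move=> El; have -> : p.[l] = (p.[l] - f l) + f l by ring.
  apply: le_trans (ler_normD _ _) _.
  by have := hp1 l El; have := (hC l El).1; lra.
have h1 : rnorm (poly_op (p * r - q) T x) <= (2 * C + 1) * e * rnorm x.
  apply: (poly_op_norm hdot _ bT sT hE) => [|l El]; first by rewrite mulr_ge0//; lra.
  rewrite !hornerE -fg//.
  have -> : p.[l] * r.[l] - f l * g l =
      p.[l] * (r.[l] - g l) + g l * (p.[l] - f l) by ring.
  apply: le_trans (ler_normD _ _) _; rewrite !normrM.
  have := ler_pM (normr_ge0 _) (normr_ge0 _) (pC l El) (hr1 l El).
  have := ler_pM (normr_ge0 _) (normr_ge0 _) (hC l El).2 (hp1 l El).
  lra.
have h2 : rnorm (poly_op p T (poly_op r T x - S' x)) <=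
    (C + 1) * (e * rnorm x).
  apply: le_trans (poly_op_norm hdot _ bT sT hE _ pC) _; first lra.
  by rewrite ler_wpM2l//; lra.
have h3 := hp2 (S' x).
have h4 : rnorm (poly_op p T (S' x) - S (S' x)) <= e * (D * rnorm x).
  by apply: le_trans h3 _; rewrite ler_wpM2l// ltW.
have -> : S (S' x) - poly_op q T x = poly_op (p * r - q) T x -
    poly_op p T (poly_op r T x - S' x) - (poly_op p T (S' x) - S (S' x)).
  rewrite (linear_opB (poly_op_linear p lT)) poly_opB poly_opM//.
  set u := poly_op p T _; set v := poly_op p T _; set w := S _; set z := poly_op q T _.
  by rewrite !opprB [u - z + _]addrC [v - u + _]addrA subrK [RHS]addrC addrA subrK.
apply: le_trans (ler_rnormD _ _) _; rewrite rnormN.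
have := ler_rnormD (poly_op (p * r - q) T x) (- poly_op p T (poly_op r T x - S' x)).
rewrite rnormN; lra.
Qed.

End SelfAdjointOperator.

Definition upper_bound b T := forall x, rdot (T x) x <= b * rdot x x.

(** For r outside [a, b], the form of T - r or of r - T is at least a positive multiple of |x|^2. *)
Lemma rsym_bounds_resolvent a b T : rsymmetric T ->
  lower_bound a T -> upper_bound b T ->
  resolvent_bound (fun l => a <= l <= b) T.
Proof.
move=> sT Ta Tb r /negP; rewrite negb_and -!ltNge => /orP[ra|br].
  apply: (@lower_bound_bounded_below _ _ _ hdot _ (a - r)); first by lra.
  by move=> x; have := Ta x; rewrite !rdotE; lra.
suff [k k0 hk] : bounded_below (fun x => - (T x - r%:C *: x)).
  by exists k => // x; rewrite -[leRHS]rnormN.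
apply: (@lower_bound_bounded_below _ _ _ hdot _ (r - b)); first by lra.
by move=> x; have := Tb x; rewrite !rdotE; lra.
Qed.

(** Polynomials within 1 / (n + 1) of f give a Cauchy sequence of operators by [poly_op_norm]. S is
    their pointwise limit; the rate d n |x| yields its linearity and boundedness. *)
Lemma fcalc_on_exists a b L f T : bounded_op T -> rsymmetric T ->
  lower_bound a T -> upper_bound b T -> a < b -> 0 <= L ->
  lipschitz_on f a b L -> exists S, fcalc_on (fun l => a <= l <= b) f T S.
Proof.
move=> bT sT Ta Tb ab L0 fL; have lT := bounded_linear bT.
have hE := rsym_bounds_resolvent sT Ta Tb.
pose d (n : nat) : R := n.+1%:R^-1.
have d_gt0 n : 0 < d n by rewrite invr_gt0 ltr0Sn.
have d0 e : 0 < e -> exists n0, forall n, (n0 <= n)%N -> d n <= e.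
  move=> e0; exists (Num.truncn e^-1) => n n0.
  rewrite /d -[e]invrK lef_pV2 ?posrE ?invr_gt0 ?ltr0Sn//.
  apply: ltW; apply: lt_le_trans (truncnS_gt _) _.
  by rewrite ler_nat ltnS.
have /choice[p hp] n := lipschitz_poly_approx ab L0 fL (d_gt0 n).
have cau x n m : rnorm (poly_op (p n) T x - poly_op (p m) T x) <=
    d n * rnorm x + d m * rnorm x.
  rewrite -poly_opB -mulrDl; apply: (poly_op_norm hdot _ bT sT hE).
    by rewrite addr_ge0// ltW.
  move=> l El; rewrite !hornerE.
  have -> : (p n).[l] - (p m).[l] =
    ((p n).[l] - f l) - ((p m).[l] - f l) by ring.
  by apply: le_trans (ler_normB _ _) _; rewrite lerD ?hp.
have /choice[S hS] x :
    exists l, forall n, rnorm (poly_op (p n) T x - l) <= d n * rnorm x.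
  apply: rnorm_cauchy (cau x) => e e0.
  have x1 : 0 < rnorm x + 1 by rewrite ltr_wpDl ?rnorm_ge0.
  have [n0 h] := d0 (e / (rnorm x + 1)) (divr_gt0 e0 x1).
  exists n0 => n /h; rewrite ler_pdivlMr//.
  have := d_gt0 n; nra.
have lS : linear S.
  move=> c x y; apply/subr0_eq/eq0_of_rnorm_le => e e0.
  pose M := rnorm (c *: x + y) + rnorm (c *: x) + rnorm y + 1.
  have M0 : 0 < M by rewrite ltr_wpDl ?addr_ge0 ?rnorm_ge0.
  have [n /(_ n (leqnn n)) hn] := d0 (e / M) (divr_gt0 e0 M0).
  have -> : S (c *: x + y) - (c *: S x + S y) =
      - (poly_op (p n) T (c *: x + y) - S (c *: x + y)) +
      (c *: (poly_op (p n) T x - S x) + (poly_op (p n) T y - S y)).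
    rewrite (poly_op_linear (p n) lT) scalerBr opprB.
    by rewrite [X in _ = _ + X]addrACA -[X in _ = _ + (_ + X)]opprD [RHS]addrA subrK.
  apply: le_trans (ler_rnormD _ _) _; rewrite rnormN.
  have h1 := ler_rnormD (c *: (poly_op (p n) T x - S x)) (poly_op (p n) T y - S y).
  have h2 : rnorm (c *: (poly_op (p n) T x - S x)) <= d n * rnorm (c *: x).
    rewrite !rnormZc mulrCA ler_wpM2l//.
    by rewrite -ler0c RRe_real ?normr_ge0// ger0_real.
  have h3 := hS y n; have h4 := hS (c *: x + y) n.
  have : d n * M <= e by rewrite -ler_pdivlMr.
  have := d_gt0 n; rewrite /M !mulrDr; lra.
exists S; split.
  apply/bounded_opP; split=> //.
  have [_ [C C0 hC]] := (bounded_opP _).1 (bounded_poly (p 0%N) bT).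
  exists (C + 1) => [|x]; first by rewrite addr_gt0.
  have -> : S x = poly_op (p 0%N) T x - (poly_op (p 0%N) T x - S x).
    by rewrite opprB addrC subrK.
  apply: le_trans (ler_rnormD _ _) _; rewrite rnormN.
  have := hS x 0%N; have := hC x; rewrite /d invr1; lra.
move=> e e0; have [n /(_ n (leqnn n)) hn] := d0 e e0.
exists (p n); split=> [l El|x]; first exact: le_trans (hp n l El) hn.
by apply: le_trans (hS x n) _; rewrite ler_wpM2r ?rnorm_ge0.
Qed.

Lemma fcalc_on_powR_exists a b s T : bounded_op T -> rsymmetric T -> 0 < a ->
  lower_bound a T -> upper_bound b T ->
  exists S, fcalc_on (fun l => a <= l <= b) (fun l => l `^ s) T S.
Proof.
move=> bT sT a0 Ta Tb.
(* The enlarged interval has positive length even when b = a. *)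
have [L L0 hL] := lipschitz_on_powR (Num.max b (a + 1)) s a0.
have [||S hS] := fcalc_on_exists bT sT Ta _ _ L0 hL.
- move=> x; apply: le_trans (Tb x) _.
  by rewrite ler_wpM2r ?(rdot_ge0 hdot)// le_max lexx.
- by rewrite lt_max ltrDl ltr01 orbT.
exists S; apply: fcalc_on_sub hS => l /andP[-> lb].
by rewrite le_max lb.
Qed.

(** The inverse is the calculus at l^(-1): its product with 'X, in either order, is the polynomial
    1. *)
Lemma lower_bound_inverse a b T : bounded_op T -> rsymmetric T -> 0 < a ->
  lower_bound a T -> upper_bound b T -> exists S, is_inverse T S.
Proof.
move=> bT sT a0 Ta Tb; have hE := rsym_bounds_resolvent sT Ta Tb.
have [S hS] := fcalc_on_powR_exists (-1) bT sT a0 Ta Tb.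
have hT := fcalc_on_poly (fun l => a <= l <= b) 'X bT.
have TX x : poly_op 'X T x = T x by apply: poly_opX.
have C0 : 0 <= `|b| + a^-1 by rewrite addr_ge0// invr_ge0 ltW.
have bnd l : a <= l <= b ->
    `|l `^ (-1)| <= `|b| + a^-1 /\ `|('X : {poly R}).[l]| <= `|b| + a^-1.
  move=> /andP[al lb]; have l0 := lt_le_trans a0 al.
  have lV0 : 0 < l^-1 by rewrite invr_gt0.
  rewrite hornerX powR_inv1 ?(ltW l0)// (gtr0_norm l0) (gtr0_norm lV0).
  have lV : l^-1 <= a^-1 by rewrite lef_pV2.
  have aV : 0 < a^-1 by rewrite invr_gt0.
  by have := ler_norm b; have := normr_ge0 b; lra.
have mulVl : forall l, a <= l <= b -> l `^ (-1) * ('X : {poly R}).[l] = (1%:P : {poly R}).[l].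
  move=> l /andP[al lb]; have l0 := lt_le_trans a0 al.
  by rewrite hornerX hornerC powR_inv1 ?(ltW l0)// mulVf// gt_eqF.
exists S; split; first exact: hS.1.
  move=> x; rewrite -TX (fcalc_on_mul bT sT hE C0 hT hS _ _ (q := 1%:P)).
  - by rewrite poly_opC scale1r.
  - by move=> l /bnd[].
  - by move=> l /mulVl <-; rewrite mulrC.
move=> x; rewrite -[X in S X]TX (fcalc_on_mul bT sT hE C0 hS hT bnd mulVl).
by rewrite poly_opC scale1r.
Qed.

Lemma real_spectrum_itv a b T l : bounded_op T -> rsymmetric T ->
  lower_bound a T -> upper_bound b T -> real_spectrum T l -> a <= l <= b.
Proof.
move=> bT sT Ta Tb hl; apply/andP; split; rewrite leNgt; apply/negP => h; apply: hl.
  apply: (@lower_bound_inverse (a - l) (b - l)); first exact: bounded_subZ.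
  - exact: rsym_subZ.
  - by lra.
  - by move=> x; have := Ta x; rewrite !rdotE; lra.
  - by move=> x; have := Tb x; rewrite !rdotE; lra.
(* For l > b the positive operator is l - T; composing its inverse with -1 inverts T - l. *)
have [|||||S [bS h1 h2]] := @lower_bound_inverse (l - b) (l - a)
    (fun x => (-1)%:C *: (T x - l%:C *: x)).
- exact: (bounded_comp (bounded_cst _ _) (bounded_subZ l bT)).
- by move=> x y; rewrite !rdotE sT.
- by lra.
- by move=> x; have := Tb x; rewrite !rdotE; lra.
- by move=> x; have := Ta x; rewrite !rdotE; lra.
exists (fun x => S ((-1)%:C *: x)); split.
- exact: (bounded_comp bS (bounded_cst _ _)).
- move=> x; have := h1 ((-1)%:C *: x).
  by rewrite rmorphN rmorph1 !scaleN1r => /oppr_inj.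
- by move=> x; apply: h2.
Qed.

(** Existence makes the [get] in [pow_op] return a true value of the calculus. A single E serves all
    exponents, so that powers can be multiplied. *)
Lemma pow_op_fcalc a b T : bounded_op T -> rsymmetric T -> 0 < a ->
  lower_bound a T -> upper_bound b T ->
  exists E, [/\ resolvent_bound E T, forall l, E l -> a <= l <= b &
    forall s, fcalc_on E (fun l => l `^ s) T (pow_op T s)].
Proof.
move=> bT sT a0 Ta Tb; exists (real_spectrum T); split.
- exact: resolvent_bound_spectrum.
- by move=> l; apply: real_spectrum_itv.
move=> s; have [S hS] := fcalc_on_powR_exists s bT sT a0 Ta Tb.
apply/is_fcalcE/(getPex (P := is_fcalc _ T)); exists S; apply/is_fcalcE.
by apply: fcalc_on_sub hS => l; apply: real_spectrum_itv.
Qed.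

End FunctionalCalculus.

(** * Bounds and powers of positive operators *)

Section Bounds.
Variables (R : realType) (H : completeNormedModType R[i]).
Variable dot : {dot H for Num.conj}.
Hypothesis hdot : is_inner_product dot.
Implicit Types (x y : H) (a b c : R) (T S : H -> H).
Local Notation rdot := (rdot dot).
Local Notation rsymmetric := (rsymmetric dot).
Local Notation lower_bound := (lower_bound dot).
Local Notation upper_bound := (upper_bound dot).

Lemma psd_Re_ge0 T x : psd_op dot T -> 0 <= rdot (T x) x.
Proof. by move=> [_ /(_ x)]; rewrite lecE => /andP[_]. Qed.

Lemma le_op_lower_bound a T : le_op dot (scalar_op a) T ->
  rsymmetric T /\ lower_bound a T.
Proof.
move=> [_ sT pT]; split=> [|x]; first exact: self_adjoint_rsym.
by have := psd_Re_ge0 x pT; rewrite !rdotE subr_ge0.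
Qed.

Lemma le_op_upper_bound b T : le_op dot T (scalar_op b) -> upper_bound b T.
Proof.
move=> [_ _ pT] x.
by have := psd_Re_ge0 x pT; rewrite !rdotE subr_ge0.
Qed.

Lemma bounded_upper_bound T : bounded_op T -> exists b, upper_bound b T.
Proof.
move=> /bounded_opP[lT [c c0 hc]]; exists c => x.
apply: le_trans (rdot_CauchySchwarz hdot _ _) _.
by rewrite -(sqr_rnorm hdot) expr2 mulrA ler_wpM2r ?rnorm_ge0.
Qed.

Lemma rsym_inverse T S : rsymmetric T -> cancel S T -> rsymmetric S.
Proof. by move=> sT ST x y; rewrite -{1}(ST y) -sT ST. Qed.

(** <S x, x> = <S x, T (S x)> >= a |S x|^2, and |x| = |T (S x)| <= C |S x|. *)
Lemma inverse_lower_bound a T S : 0 < a -> bounded_op T -> lower_bound a T ->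
  cancel S T -> exists2 c, 0 < c & lower_bound c S.
Proof.
move=> a0 /bounded_opP[lT [C C0 hC]] Ta ST.
exists (a / C ^+ 2) => [|x]; first by rewrite divr_gt0// exprn_gt0.
rewrite mulrAC ler_pdivrMr ?exprn_gt0// rdotC -[x in rdot x (S x)]ST.
have := Ta (S x); rewrite ST => h.
rewrite [leRHS]mulrC; apply: le_trans (ler_wpM2l (sqr_ge0 C) h).
rewrite mulrCA ler_wpM2l ?(ltW a0)// -!(sqr_rnorm hdot) -exprMn.
rewrite lerXn2r ?nnegrE ?mulr_ge0 ?rnorm_ge0 ?(ltW C0)//.
by rewrite -[X in rnorm X <= _]ST.
Qed.

(** For [lower_bound_crit], a negative c is handled by positivity and 0 <= c < a by the triangle
    inequality. It serves for G, where |G y| is what can be estimated. *)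
Lemma psd_norm_lower_bound a T : bounded_op T -> rsymmetric T ->
  lower_bound 0 T -> (forall x, a * rnorm x <= rnorm (T x)) -> lower_bound a T.
Proof.
move=> bT sT T0 Ta; apply: lower_bound_crit => // c ca.
have [c0|c0] := leP 0 c; last first.
  apply: (@lower_bound_bounded_below _ _ _ hdot _ (- c)); first by rewrite oppr_gt0.
  by move=> x; have := T0 x; rewrite !rdotE; lra.
exists (a - c) => [|x]; first by rewrite subr_gt0.
have := ler_rnormD (T x - c%:C *: x) (c%:C *: x).
by rewrite subrK rnormZ ger0_norm//; have := Ta x; lra.
Qed.

Lemma quad_rdot T x : quad dot T x = rdot (T x) x.
Proof. by []. Qed.

End Bounds.

Section SquareRoots.
Variables (R : realType) (H : completeNormedModType R[i]).
Variable dot : {dot H for Num.conj}.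
Hypothesis hdot : is_inner_product dot.
Variables (T : H -> H) (a b : R).
Hypotheses (bT : bounded_op T) (sT : rsymmetric dot T) (a0 : 0 < a).
Hypotheses (Ta : lower_bound dot a T) (Tb : upper_bound dot b T).
Local Notation rdot := (rdot dot).
Local Notation lower_bound := (lower_bound dot).

Lemma bounded_pow_op s : bounded_op (pow_op T s).
Proof. by have [E [_ _ /(_ s)[]]] := pow_op_fcalc hdot bT sT a0 Ta Tb. Qed.

Lemma rsym_pow_op s : rsymmetric dot (pow_op T s).
Proof.
have [E [_ _ /(_ s)]] := pow_op_fcalc hdot bT sT a0 Ta Tb.
exact: (fcalc_on_rsym hdot (bounded_linear bT) sT).
Qed.

Lemma pow_op_ge s q x : (forall l, a <= l <= b -> q.[l] <= l `^ s) ->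
  rdot (poly_op q T x) x <= rdot (pow_op T s x) x.
Proof.
have [E [hE Eab /(_ s) hs]] := pow_op_fcalc hdot bT sT a0 Ta Tb.
by move=> hq; apply: (fcalc_on_ge hdot bT sT hE x hs) => l /Eab; apply: hq.
Qed.

Lemma lower_bound_pow_op s : lower_bound 0 (pow_op T s).
Proof.
move=> x; have := @pow_op_ge s 0%:P x.
rewrite poly_opC rdotE; apply=> l _; rewrite hornerC; exact: powR_ge0.
Qed.

Lemma pow_op_mul r s q x :
  (forall l, a <= l <= b -> l `^ r * l `^ s = q.[l]) ->
  pow_op T r (pow_op T s x) = poly_op q T x.
Proof.
have [E [hE Eab hs]] := pow_op_fcalc hdot bT sT a0 Ta Tb.
move=> hq; pose C := a `^ r + b `^ r + (a `^ s + b `^ s).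
have C0 : 0 <= C by rewrite !addr_ge0// powR_ge0.
apply: (fcalc_on_mul hdot bT sT hE C0 (hs r) (hs s)) => l /Eab lab; last exact: hq.
rewrite !ger0_norm ?powR_ge0// /C.
have := powR_le_endpoints r a0 lab; have := powR_le_endpoints s a0 lab.
have := powR_ge0 a r; have := powR_ge0 a s.
have := powR_ge0 b r; have := powR_ge0 b s; lra.
Qed.

Lemma pow_op_half_sqr x : pow_op T 2^-1 (pow_op T 2^-1 x) = T x.
Proof.
rewrite (@pow_op_mul _ _ 'X) ?poly_opX// => l /andP[al _].
have l0 := lt_le_trans a0 al.
rewrite hornerX -powRD ?(gt_eqF l0) ?implybT//.
by rewrite -[X in X + _]mul1r -[X in _ + X]mul1r -splitr powRr1// ltW.
Qed.

Lemma pow_op_opp r x : pow_op T r (pow_op T (- r) x) = x.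
Proof.
rewrite (@pow_op_mul _ _ 1%:P) ?poly_opC ?scale1r// => l /andP[al _].
have l0 := lt_le_trans a0 al.
by rewrite hornerC -powRD ?(gt_eqF l0) ?implybT// subrr powRr0.
Qed.

End SquareRoots.

(** * Scalar inequalities and the comparison of means *)

(** AM-GM: 4 p (m M q) <= (p + m M q)^2 <= s^2. This turns both sum bounds of Kantorovich type into
    product bounds. *)
Lemma mulr_le_sqr_sum (R : realFieldType) (m M p q s : R) : 0 < m -> 0 < M ->
  0 <= p -> 0 <= q -> p + m * M * q <= s -> p * q <= s ^+ 2 / (4 * M * m).
Proof.
move=> m0 M0 p0 q0 pq; rewrite ler_pdivlMr; last by rewrite !mulr_gt0.
have := sqr_ge0 (p - m * M * q).
have : 0 <= m * M * q by rewrite !mulr_ge0// ltW.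
nra.
Qed.

(** Here al, be, ga, g, h stand for the quadratic forms of A, B, A^-1, G, G^t at x, and z for that
    of the spectral mean. Weighting al <= k / ga and be <= k g^2 / ga gives k g^(2 t) / ga, while
    K^2 g^(2 t) <= h^2 <= z ga. *)
Lemma weighted_product_bound (R : realType) (t al be ga g z h K k : R) :
  0 <= t <= 1 -> 0 < ga -> 0 <= al -> 0 <= be -> 0 <= g -> 0 < K -> 0 <= k ->
  al * ga <= k -> be * ga <= k * g ^+ 2 ->
  K * g `^ t <= h -> h ^+ 2 <= z * ga ->
  al `^ (1 - t) * be `^ t <= 1 / K ^+ 2 * k * z.
Proof.
move=> /andP[t0 t1] ga0 al0 be0 g0 K0 k0 hal hbe hg hz.
have kga : 0 <= k / ga by rewrite divr_ge0// ltW.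
have hal' : al <= k / ga by rewrite ler_pdivlMr.
have hbe' : be <= k / ga * g ^+ 2 by rewrite mulrAC ler_pdivlMr.
have t10 : 0 <= 1 - t by rewrite subr_ge0.
apply: (@le_trans _ _ ((k / ga) `^ (1 - t) * (k / ga * g ^+ 2) `^ t)).
  apply: ler_pM; rewrite ?powR_ge0// ge0_ler_powR// nnegrE//.
  by rewrite mulr_ge0// sqr_ge0.
rewrite (powRM t kga (sqr_ge0 g)) mulrA -powRD; last first.
  by rewrite subrK oner_eq0.
have -> : (g ^+ 2) `^ t = (g `^ t) ^+ 2.
  by rewrite -(powR_mulrn 2 g0) powRAC powR_mulrn ?powR_ge0.
rewrite subrK powRr1//.
have K2 : 0 < K ^+ 2 by rewrite exprn_gt0.
have hKg : K ^+ 2 * (g `^ t) ^+ 2 <= z * ga.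
  apply: le_trans hz; rewrite -exprMn lerXn2r ?nnegrE ?mulr_ge0 ?powR_ge0 ?(ltW K0)//.
  by apply: le_trans hg; rewrite mulr_ge0 ?powR_ge0// ltW.
have -> : k / ga * (g `^ t) ^+ 2 = k / (ga * K ^+ 2) * (K ^+ 2 * (g `^ t) ^+ 2).
  by field; rewrite !gt_eqF.
have -> : 1 / K ^+ 2 * k * z = k / (ga * K ^+ 2) * (z * ga).
  by field; rewrite !gt_eqF.
by rewrite ler_wpM2l// divr_ge0// mulr_ge0// ltW.
Qed.

Theorem theorem2p2 (R : realType) (H : completeNormedModType R[i])
    (dot : {dot H for Num.conj}) (hdot : is_inner_product dot)
    (A B : H -> H) (hA : bounded_op A) (hB : bounded_op B)
    (m M : R) (hm : 0 < m)
    (hmA : le_op dot (scalar_op m) A) (hAM : le_op dot A (scalar_op M))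
    (hmB : le_op dot (scalar_op m) B) (hBM : le_op dot B (scalar_op M))
    (t : R) (ht0 : 0 <= t) (ht1 : t <= 1)
    (x : H) (hx : `|x| = 1) :
  quad dot A x `^ (1 - t) * quad dot B x `^ t <=
  1 / kantorovich (Num.sqrt (m / M)) (Num.sqrt (M / m)) t ^+ 2 *
  ((M + m) ^+ 2 / (4 * M * m)) * quad dot (spectral_geo_mean t A B) x.
Proof.
have [sA mA] := le_op_lower_bound hmA; have AM := le_op_upper_bound hAM.
have [sB mB] := le_op_lower_bound hmB; have BM := le_op_upper_bound hBM.
have xx : rdot dot x x = 1 by rewrite -(sqr_rnorm hdot) /rnorm hx expr1n.
have mM : m <= M by have := mA x; have := AM x; rewrite xx; lra.
have M0 : 0 < M := lt_le_trans hm mM.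
have lA := bounded_linear hA.
have [bA' A'K AK'] : is_inverse A (inv_op A).
  exact: (getPex (lower_bound_inverse hdot hA sA hm mA AM)).
rewrite /spectral_geo_mean /geo_mean; set A' := inv_op A in bA' A'K AK' *.
have sA' := rsym_inverse sA A'K.
(* Any positive lower bound and any upper bound of A' will do: they only give access to the powers P
   and Q. *)
have [a' a'0 A'a] := inverse_lower_bound hdot hm hA mA A'K.
have [b' A'b] := bounded_upper_bound hdot bA'.
set P := pow_op A' 2^-1; set Q := pow_op A' (- 2^-1).
have sP : rsymmetric dot P := rsym_pow_op hdot bA' sA' a'0 A'a A'b _.
have sQ : rsymmetric dot Q := rsym_pow_op hdot bA' sA' a'0 A'a A'b _.
have bP : bounded_op P := bounded_pow_op hdot bA' sA' a'0 A'a A'b _.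
have bQ : bounded_op Q := bounded_pow_op hdot bA' sA' a'0 A'a A'b _.
have PP y : P (P y) = A' y := pow_op_half_sqr hdot bA' sA' a'0 A'a A'b y.
have PQ y : P (Q y) = y := pow_op_opp hdot bA' sA' a'0 A'a A'b _ y.
have QP y : Q (P y) = y.
  by have := pow_op_opp hdot bA' sA' a'0 A'a A'b (- 2^-1) y; rewrite opprK.
have QQ y : Q (Q y) = A y by rewrite -{1}(AK' y) -PP !QP.
set E := Q \o B \o Q.
have bE : bounded_op E := bounded_comp (bounded_comp bQ hB) bQ.
have sE : rsymmetric dot E by move=> u v; rewrite /E /= sQ sB sQ.
(* Since Q Q = A, <E y, y> = <B Q y, Q y> >= m |Q y|^2 = m <A y, y> >= m^2 |y|^2, and likewise from
   above. *)
have Elo : lower_bound dot (m ^+ 2) E.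
  move=> y; rewrite /E /= sQ; apply: le_trans (mB _).
  by rewrite -sQ QQ expr2 -mulrA ler_wpM2l// ltW.
have Eup : upper_bound dot (M ^+ 2) E.
  move=> y; rewrite /E /= sQ; apply: le_trans (BM _) _.
  by rewrite -sQ QQ expr2 -mulrA ler_wpM2l// ltW.
have m2 : 0 < m ^+ 2 by rewrite exprn_gt0.
set D := pow_op E 2^-1.
have bD : bounded_op D := bounded_pow_op hdot bE sE m2 Elo Eup _.
have sD : rsymmetric dot D := rsym_pow_op hdot bE sE m2 Elo Eup _.
have DD y : D (D y) = E y := pow_op_half_sqr hdot bE sE m2 Elo Eup y.
have D0 : lower_bound dot 0 D := lower_bound_pow_op hdot bE sE m2 Elo Eup _.
(* (D - m)(M - D) >= 0 *)
have Dquad y : rdot dot (E y) y + m * M * rdot dot y y <=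
    (M + m) * rdot dot (D y) y.
  have := @pow_op_ge _ _ _ hdot _ _ _ bE sE m2 Elo Eup 2^-1
    ((M + m)^-1 *: ('X + (m * M)%:P)) y.
  have Mm : 0 < M + m by rewrite addr_gt0.
  rewrite !poly_opW !rdotE ler_pdivrMl//; apply=> l /andP[ml lM].
  have l0 : 0 <= l := le_trans (ltW m2) ml.
  rewrite !hornerE ler_pdivrMl// powR12_sqrt//.
  have := sqrtr_ge0 l; have := sqr_sqrtr l0; set r := Num.sqrt l => rl r0.
  have mr : m <= r by rewrite -ler_sqr ?nnegrE ?(ltW hm)// rl.
  have rM : r <= M by rewrite -ler_sqr ?nnegrE ?(ltW M0)// rl.
  rewrite -rl; nra.
set G := P \o D \o P.
have bG : bounded_op G := bounded_comp (bounded_comp bP bD) bP.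
have sG : rsymmetric dot G by move=> u v; rewrite /G /= sP sD sP.
(* P A P is the identity, so G A G = P D D P = P E P = B. *)
have GAG y : G (A (G y)) = B y.
  rewrite /G /=; set u := P y; have -> : P (A (P (D u))) = D u.
    by rewrite -QQ PQ QP.
  by rewrite DD /E /= PQ QP.
have G0 : lower_bound dot 0 G.
  by move=> y; rewrite mul0r /G /= sP; have := D0 (P y); rewrite mul0r.
have AG y : rdot dot (A (G y)) (G y) = rdot dot (B y) y by rewrite -sG GAG.
(* M |G y|^2 >= <A G y, G y> = <B y, y> >= m |y|^2. Exchanging the roles of m and M bounds |G y|
   from above. *)
have Glo : lower_bound dot (Num.sqrt (m / M)) G.
  apply: psd_norm_lower_bound => // y.
  rewrite -ler_sqr ?nnegrE ?mulr_ge0 ?sqrtr_ge0 ?rnorm_ge0// exprMn sqr_sqrtr; last first.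
    by rewrite divr_ge0// ltW.
  rewrite !(sqr_rnorm hdot) mulrAC ler_pdivrMr// mulrC [leRHS]mulrC mulrC.
  by apply: le_trans (mB y) _; rewrite -AG; apply: AM.
have Gup : upper_bound dot (Num.sqrt (M / m)) G.
  move=> y; apply: le_trans (rdot_CauchySchwarz hdot _ _) _.
  rewrite -(sqr_rnorm hdot) expr2 mulrA ler_wpM2r ?rnorm_ge0//.
  rewrite -ler_sqr ?nnegrE ?mulr_ge0 ?sqrtr_ge0 ?rnorm_ge0// exprMn sqr_sqrtr; last first.
    by rewrite divr_ge0// ltW.
  rewrite !(sqr_rnorm hdot) mulrAC ler_pdivlMr// mulrC.
  by apply: le_trans (mA _) _; rewrite AG; apply: BM.
have a0 : 0 < Num.sqrt (m / M) by rewrite sqrtr_gt0 divr_gt0.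
have ab : Num.sqrt (m / M) <= Num.sqrt (M / m).
  by rewrite ler_wsqrtr// ler_pdivrMr// mulrAC ler_pdivlMr//; nra.
set a := Num.sqrt (m / M) in Glo a0 ab *; set b := Num.sqrt (M / m) in Gup ab *.
have t01 : 0 <= t <= 1 by rewrite ht0.
have [K0 [al [be [chord Kchord]]]] := kantorovich_chord a0 ab t01.
set W := pow_op G t.
have sW : rsymmetric dot W := rsym_pow_op hdot bG sG a0 Glo Gup _.
set ga := rdot dot (A' x) x; set g := rdot dot (G x) x.
set y := W x.
(* By symmetry of W = G^t, the form of the spectral mean at x is <A y, y> with y = W x. *)
rewrite !quad_rdot /= -/W -/y sW -/y.
set z := rdot dot (A y) y.
have ag : a <= g <= b by have := Glo x; have := Gup x; rewrite xx !mulr1 => -> ->.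
have g0 : 0 <= g by case/andP: ag => /(le_trans (ltW a0)).
have Wg : kantorovich a b t * g `^ t <= rdot dot y x.
  apply: le_trans (Kchord g ag) _.
  have := @pow_op_ge _ _ _ hdot _ _ _ bG sG a0 Glo Gup t (al *: 'X + be%:P) x.
  rewrite !poly_opW !rdotE xx mulr1; apply=> l lab.
  by rewrite !hornerE; apply: chord.
have ga0 : 0 < ga.
  by have := A'a x; rewrite xx mulr1; apply: lt_le_trans.
(* As A A' x = x, the form of A at y + s A' x is z + 2 s <y, x> + s^2 ga. *)
have yz : rdot dot y x ^+ 2 <= z * ga.
  apply: discriminant_le0 => s.
  have := mA (y + s%:C *: A' x).
  have Aw : A (y + s%:C *: A' x) = A y + s%:C *: x.
    by rewrite (linear_opD lA) (linear_opZ lA) A'K.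
  have := mulr_ge0 (ltW hm) (rdot_ge0 hdot (y + s%:C *: A' x)).
  move=> h1 h2; have := le_trans h1 h2; rewrite Aw !rdotE -/z.
  rewrite (sA y) A'K (rdotC _ x (A' x)) -/ga (rdotC _ x y); lra.
have k0 : 0 <= (M + m) ^+ 2 / (4 * M * m).
  by rewrite divr_ge0 ?sqr_ge0// !mulr_ge0 ?ltW.
have mM4 : 0 < 4 * M * m by rewrite !mulr_gt0.
have al0 : 0 <= rdot dot (A x) x.
  by have := mA x; rewrite xx mulr1; apply: le_trans; exact: ltW.
have be0 : 0 <= rdot dot (B x) x.
  by have := mB x; rewrite xx mulr1; apply: le_trans; exact: ltW.
have alga : rdot dot (A x) x * ga <= (M + m) ^+ 2 / (4 * M * m).
  apply: mulr_le_sqr_sum => //; rewrite ?(ltW ga0)//.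
  (* q(l) = l (l - m) (M - l). Evaluated at A on the vector A' x, the extra factor l turns <q(A) A'
     x, A' x> >= 0 into <A x, x> + m M ga <= M + m. *)
  pose q : {poly R} := (M + m) *: ('X * 'X) - 'X * ('X * 'X) - (m * M) *: 'X.
  have : 0 <= rdot dot (poly_op q A (A' x)) (A' x).
    have := lower_bound_poly hdot hA sA (rsym_bounds_resolvent hdot sA mA AM).
    move=> /(_ q 0 _ (A' x)); rewrite mul0r; apply=> l /andP[ml lM].
    rewrite [leRHS](_ : _ = l * ((l - m) * (M - l))); last first.
      by rewrite /q !(hornerD, hornerN, hornerZ, hornerM, hornerX); ring.
    by rewrite !mulr_ge0 ?subr_ge0// (le_trans (ltW hm)).
  rewrite !(poly_opW, poly_opM _ _ _ lA) A'K !rdotE !sA A'K xx.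
  by rewrite (rdotC _ x (A' x)) -/ga; lra.
have bega : rdot dot (B x) x * ga <= (M + m) ^+ 2 / (4 * M * m) * g ^+ 2.
  rewrite mulrAC -exprMn; apply: mulr_le_sqr_sum => //; rewrite ?(ltW ga0)//.
  (* At P x the three forms of [Dquad] become <B x, x>, ga and g. *)
  by have := Dquad (P x); rewrite /E /= QP sQ QP -!sP PP.
exact: weighted_product_bound Wg yz.
Qed.
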